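(* Let $K$ be a finite field, $d \geq 1$ an integer and $G$ a group such that the full vector shift $(K^d)^G$ admits a linear cellular automaton of infinite order. Then there exists a Lie algebraic $G$-subshift $X$ over $K$ that is not cellwiseable and whose co-homoclinic factor $X/\overline{\Delta_X}$ is isomorphic to the additive group of $K$.
   Context: Let $G$ be a group and $A$ a finite alphabet. The full shift $A^G$ has the product topology and the left shift action $(gx)_h = x_{g^{-1}h}$. A $G$-subshift is a closed $G$-invariant subset $X \subset A^G$. A block code $f : X \to Y$ between $G$-subshifts $X \subset A^G$, $Y \subset B^G$ is a continuous $G$-equivariant map; equivalently, there are a finite set $N \subset G$ (a neighborhood of $f$) and a local function $F : A^N \to B$ with $f(x)_g = F((g^{-1}x)|_N)$. Finite powers $X^n$ are regarded as subshifts of $(A^n)^G$, so $n$-ary block codes $X^n \to X$ make sense (for $n = 0$, a $G$-invariant element of $X$). A topological conjugacy is a bijective block code. A Lie algebraic $G$-subshift over a finite field $K$ is a $G$-subshift $X$ equipped with block codes for the zero element $0$ (nullary), scalar multiplication $x \mapsto ax$ for each $a \in K$, addition $(x,y) \mapsto x+y$ and a bracket $(x,y) \mapsto [x,y]$, which make $X$ a Lie algebra over $K$ (the bracket is bilinear, satisfies $[x,x]=0$ and the Jacobi identity). It is cellwise if each of these operations admits $\{1_G\}$ as a neighborhood. It is cellwiseable if there is a cellwise Lie algebraic $G$-subshift $Y$ over $K$ and a topological conjugacy $\phi : X \to Y$ that is also an isomorphism of Lie algebras over $K$. A point $x \in X$ is homoclinic if $gx \to 0$ as $g$ escapes finite subsets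 of $G$; $\Delta_X$ is the subgroup of $(X,+)$ of all homoclinic points, and the co-homoclinic factor is the quotient $X/\overline{\Delta_X}$ by its closure. The full vector shift $(K^d)^G$ carries the cellwise $K$-vector space operations. A linear cellular automaton on it is a block code $f : (K^d)^G \to (K^d)^G$ that is $K$-linear. It has infinite order if its powers $f^n$, $n \geq 0$, are pairwise distinct. *)

(* Defs.v *)
From HB Require Import structures.
Set Warnings "-ambiguous-paths,-notation-incompatible-prefix,-notation-overridden".
From mathcomp Require Import all_boot all_order all_algebra finmap.
From mathcomp Require Import all_classical all_reals all_analysis.

Set Implicit Arguments.
Unset Strict Implicit.
Unset Printing Implicit Defensive.

Import GRing.Theory.

Local Open Scope classical_set_scope.
Local Open Scope ring_scope.

(* [discrete_topology] fixes the topology of the alphabet even when A carries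
   another one. *)
Definition config (G : groupType) (A : finType) :=
  {ptws G -> discrete_topology A}.

Definition gshift (G : groupType) (A : finType) (g : G) (x : config G A) :
  config G A := fun h => x (g^-1 * h)%g.

Definition is_subshift (G : groupType) (A : finType) (X : set (config G A)) :=
  closed X /\ forall (g : G) x, X x -> X (gshift g x).

(* Maps between subshifts are represented by total functions between the
   ambient full shifts; only their values on the domain are ever constrained. *)
Definition is_block_code (G : groupType) (A B : finType)
    (X : set (config G A)) (Y : set (config G B))
    (f : config G A -> config G B) :=
  [/\ set_fun X Y f,
      {within X, continuous f} &
      forall (g : G) x, X x -> f (gshift g x) = gshift g (f x)].

(* The argument of F is the restriction of g^-1 x to N. *)
Definition admits_neighborhood (G : groupType) (A B : finType)
    (N : {fset G}) (X : set (config G A)) (f : config G A -> config G B) :=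
  exists F : {ffun N -> A} -> B, forall x, X x ->
    forall g : G, f x g = F [ffun n : N => gshift g^-1%g x (val n)].

Definition is_conjugacy (G : groupType) (A B : finType)
    (X : set (config G A)) (Y : set (config G B))
    (f : config G A -> config G B) :=
  is_block_code X Y f /\ set_bij X Y f.

(* X * X, regarded as a subset of (A * A)^G instead of A^G * A^G *)
Definition subshift_square (G : groupType) (A : finType) (X : set (config G A)) :
    set (config G (A * A)%type) :=
  [set z | X (fun g => (z g).1) /\ X (fun g => (z g).2)].

(* Operations of arity 0 and 2 as maps from the full shift over A^0 = unit and
   from (A * A)^G, so that [is_block_code] and [admits_neighborhood] apply. *)
Definition nullary (G : groupType) (A : finType) (c : config G A) :
    config G unit -> config G A := fun=> c.

Definition binary (G : groupType) (A : finType)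
    (op : config G A -> config G A -> config G A) :
    config G (A * A)%type -> config G A :=
  fun z => op (fun g => (z g).1) (fun g => (z g).2).

Record lie_subshift (K : finFieldType) (G : groupType) (A : finType) :=
  LieSubshift {
    lie_carrier :> set (config G A);
    lie_zero : config G A;
    lie_scale : K -> config G A -> config G A;
    lie_add : config G A -> config G A -> config G A;
    lie_bracket : config G A -> config G A -> config G A;

    lie_carrier_subshift : is_subshift lie_carrier;
    lie_zero_code : is_block_code [set: config G unit] lie_carrier (nullary lie_zero);
    lie_scale_code : forall a, is_block_code lie_carrier lie_carrier (lie_scale a);
    lie_add_code : is_block_code (subshift_square lie_carrier) lie_carrier (binary lie_add);
    lie_bracket_code : is_block_code (subshift_square lie_carrier) lie_carrier (binary lie_bracket);

    lie_addA : {in lie_carrier & &, associative lie_add};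
    lie_addC : {in lie_carrier &, commutative lie_add};
    lie_add0 : {in lie_carrier, left_id lie_zero lie_add};
    lie_addN : {in lie_carrier, forall x, exists2 y, lie_carrier y & lie_add y x = lie_zero};

    lie_scaleA : forall a b, {in lie_carrier, forall x,
      lie_scale a (lie_scale b x) = lie_scale (a * b) x};
    lie_scale1 : {in lie_carrier, forall x, lie_scale 1 x = x};
    lie_scaleDr : forall a, {in lie_carrier &, {morph lie_scale a : x y / lie_add x y}};
    lie_scaleDl : forall a b, {in lie_carrier, forall x,
      lie_scale (a + b) x = lie_add (lie_scale a x) (lie_scale b x)};

    lie_bracketDl : {in lie_carrier & &, left_distributive lie_bracket lie_add};
    lie_bracketDr : {in lie_carrier & &, right_distributive lie_bracket lie_add};
    lie_bracketZl : forall a, {in lie_carrier &, forall x y,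
      lie_bracket (lie_scale a x) y = lie_scale a (lie_bracket x y)};
    lie_bracketZr : forall a, {in lie_carrier &, forall x y,
      lie_bracket x (lie_scale a y) = lie_scale a (lie_bracket x y)};
    lie_bracketxx : {in lie_carrier, forall x, lie_bracket x x = lie_zero};
    lie_jacobi : {in lie_carrier & &, forall x y z,
      lie_add (lie_bracket x (lie_bracket y z))
        (lie_add (lie_bracket y (lie_bracket z x)) (lie_bracket z (lie_bracket x y))) = lie_zero}
  }.

Arguments lie_scale {K G A}.
Arguments lie_add {K G A}.
Arguments lie_bracket {K G A}.
Arguments lie_zero {K G A}.

Definition cellwise (K : finFieldType) (G : groupType) (A : finType)
    (X : lie_subshift K G A) :=
  let N := [fset 1%g : G]%fset in
  [/\ admits_neighborhood N [set: config G unit] (nullary (lie_zero X)),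
      forall a, admits_neighborhood N X (lie_scale X a),
      admits_neighborhood N (subshift_square X) (binary (lie_add X)) &
      admits_neighborhood N (subshift_square X) (binary (lie_bracket X))].

Definition is_lie_morphism (K : finFieldType) (G : groupType) (A B : finType)
    (X : lie_subshift K G A) (Y : lie_subshift K G B)
    (f : config G A -> config G B) :=
  [/\ forall a, {in lie_carrier X, {morph f : x / lie_scale X a x >-> lie_scale Y a x}},
      {in lie_carrier X &, {morph f : x y / lie_add X x y >-> lie_add Y x y}} &
      {in lie_carrier X &, {morph f : x y / lie_bracket X x y >-> lie_bracket Y x y}}].

Definition cellwiseable (K : finFieldType) (G : groupType) (A : finType)
    (X : lie_subshift K G A) :=
  exists (B : finType) (Y : lie_subshift K G B)
    (f : config G A -> config G B),
  [/\ cellwise Y, is_conjugacy X Y f & is_lie_morphism X Y f].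

Definition homoclinic (K : finFieldType) (G : groupType) (A : finType)
    (X : lie_subshift K G A) : set (config G A) :=
  [set x | lie_carrier X x /\ (fun g : G => gshift g x) @ (@frechet_filter G : set_system G) --> lie_zero X].

(* The elements are the cosets of closure (homoclinic X) in X, a set of sets;
   as usual for subgroups of an abelian group, the sum of two cosets is
   their elementwise sum. *)
Definition cohomoclinic_factor (K : finFieldType) (G : groupType)
    (A : finType) (X : lie_subshift K G A) : set (set (config G A)) :=
  (fun x => lie_add X x @` closure (homoclinic X)) @` lie_carrier X.

Definition coset_add (K : finFieldType) (G : groupType) (A : finType)
    (X : lie_subshift K G A) (C D : set (config G A)) : set (config G A) :=
  [set lie_add X x y | x in C & y in D].

Definition cohomoclinic_factor_isog (K : finFieldType) (G : groupType)
    (A : finType) (X : lie_subshift K G A) (V : zmodType) :=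
  exists2 psi : set (config G A) -> V,
    set_bij (cohomoclinic_factor X) [set: V] psi &
    {in cohomoclinic_factor X &,
      {morph psi : C D / coset_add X C D >-> C + D}}.

Definition is_linear_ca (K : finFieldType) (G : groupType) (d : nat)
    (f : config G 'rV[K]_d -> config G 'rV[K]_d) :=
  is_block_code [set: config G 'rV[K]_d] [set: config G 'rV[K]_d] f /\
  linear (f : (G -> 'rV[K]_d) -> (G -> 'rV[K]_d)).

Definition infinite_order (T : Type) (f : T -> T) :=
  injective (fun n => iter n f).

(* Main.v *)
Require Import Defs.
From HB Require Import structures.
Set Warnings "-ambiguous-paths,-notation-incompatible-prefix,-notation-overridden".
From mathcomp Require Import all_boot all_order all_algebra finmap.
From mathcomp Require Import all_classical all_reals all_analysis.
From mathcomp Require Import ring.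

Set Implicit Arguments.
Unset Strict Implicit.
Unset Printing Implicit Defensive.

Import GRing.Theory.

Local Open Scope classical_set_scope.
Local Open Scope ring_scope.

(* Let f be a linear cellular automaton of infinite order, and let the
   one-dimensional Lie algebra K of constant configurations act on the abelian
   Lie algebra V = (K^d)^G through f.  The semidirect product of K and V, with
   bracket [(s, u), (t, v)] = (0, s f(v) - t f(u)), is a Lie algebraic
   G-subshift X over the alphabet K x K^d.  The adjoint action of the fixed
   point (1, 0) restricts to f on V, so its powers are pairwise distinct; in a
   cellwise subshift, the adjoint action of a fixed point applies a self-map of
   the finite alphabet in each cell, so that two of its powers coincide.  Since
   f has infinite order, G is infinite, so a nonzero constant is not homoclinic,
   and the finitely supported points are dense in V: the closure of the
   homoclinic points is V, and X / V = K. *)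

(** * The product topology on configurations, read cell by cell *)

Lemma cvg_configP (G : groupType) (A : finType) (F : set_system (config G A))
    (x : config G A) : Filter F ->
  F --> x <-> forall g : G, F [set y | y g = x g].
Proof.
move=> FF; split=> [Fx g|Fx].
  have cg : {for x, continuous
      ((fun y : config G A => y g) : config G A -> discrete_topology A)}.
    exact: (@proj_continuous G (fun=> discrete_topology A) g x).
  by have := Fx _ (cg [set x g] _); apply; exact: discrete_set1.
apply/cvg_sup => g U [V [[W] oW <-] Wx WU].
by apply: filterS (Fx g) => y /= yx; apply: WU; rewrite /= yx.
Qed.

Lemma nbhs_config_coord (G : groupType) (A : finType) (x : config G A) (g : G) :
  nbhs x [set y | y g = x g].
Proof. by have [xP _] := cvg_configP x (nbhs_filter x); exact: xP. Qed.

(** The sets containing a cylinder around [x] form a filter; it converges to [x] by [cvg_configP],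
    hence contains all neighborhoods of [x]. *)
Lemma nbhs_configP (G : groupType) (A : finType) (x : config G A)
    (U : set (config G A)) :
  nbhs x U -> exists S : seq G, forall y, {in S, y =1 x} -> U y.
Proof.
pose F : set_system (config G A) :=
  [set V | exists S : seq G, forall y, {in S, y =1 x} -> V y].
have FF : Filter F.
  split; first by exists [::].
  - move=> P Q [S SP] [T TQ]; exists (S ++ T) => y yx.
    by split; [apply: SP | apply: TQ] => g gS; apply: yx;
      rewrite mem_cat gS ?orbT.
  - by move=> P Q PQ [S SP]; exists S => y /SP /PQ.
suff Fx : F --> x by move/Fx.
apply/(cvg_configP x FF) => g; exists [:: g] => y yx.
by apply: yx; exact: mem_head.
Qed.

Lemma continuous_configP (G : groupType) (A B : finType)
    (f : config G A -> config G B) :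
  continuous f <-> forall x (g : G), \forall y \near x, f y g = f x g.
Proof.
split=> [cf x g|cf x].
  have [fP _] := cvg_configP (f x) (fmap_filter f (nbhs_filter x)).
  exact: fP (cf x) g.
have [_] := cvg_configP (f x) (fmap_filter f (nbhs_filter x)).
by apply=> g; exact: cf.
Qed.

(** Escaping finite subsets means following the cofinite filter on [G], so [cvg_configP] turns the
    limit into a finiteness condition at each cell [h]. *)
Lemma homoclinicP (K : finFieldType) (G : groupType) (A : finType)
    (X : lie_subshift K G A) (x : config G A) :
  infinite_set [set: G] ->
  homoclinic X x <->
  lie_carrier X x /\
    forall h, finite_set [set g : G | x (g^-1 * h)%g <> lie_zero X h].
Proof.
move=> infG; rewrite /homoclinic /=.
have FF := frechet_properfilter infG.
have [H1 H2] := cvg_configP (lie_zero X) (fmap_filter (fun g => gshift g x) FF).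
split=> -[Xx]; last first.
  by move=> fx; split=> //; apply: H2.
by move=> /H1 fx; split=> //; apply: fx.
Qed.

(** * Coinciding iterates and the obstruction to cellwiseability *)

(** Pigeonhole: one more iterate is listed than there are self-maps of [B]. *)
Lemma fin_iter_collision (B : finType) (u : B -> B) :
  exists m n : nat, m <> n /\ iter m u =1 iter n u.
Proof.
pose F (i : 'I_(#|{ffun B -> B}|.+1)) : {ffun B -> B} := [ffun b => iter i u b].
have /injectivePn[i [j ij Fij]] : ~~ injectiveb F.
  by apply/negP => /injectiveP /leq_card; rewrite card_ord ltnn.
exists i, j; split=> [/ord_inj/eqP|b]; first by rewrite (negPf ij).
by move/ffunP/(_ b): Fij; rewrite !ffunE.
Qed.

(** Over a finite group the full shift is itself finite: the encoding [r] with inverse [e] turns [f]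
    into a self-map [u] of a finite type, and two iterates of [u] coincide. *)
Lemma infinite_order_infinite (G : groupType) (A : finType)
    (f : config G A -> config G A) :
  infinite_order f -> infinite_set [set: G].
Proof.
move=> finj /finite_fsetP[S GS].
have inS g : g \in S by have : [set` S] g by rewrite -GS.
pose r (x : config G A) : {ffun S -> A} := [ffun s => x (val s)].
pose e (v : {ffun S -> A}) : config G A := fun g => v [` inS g]%fset.
have rK x : e (r x) = x by apply/funext => g; rewrite /e ffunE.
pose u v := r (f (e v)).
have fE n x : r (iter n f x) = iter n u (r x).
  by elim: n => // n IHn; rewrite !iterS -IHn /u rK.
have [m [n [mn uE]]] := fin_iter_collision u.
by apply/mn/finj/funext => x; rewrite -[LHS]rK -[RHS]rK !fE uE.
Qed.

Lemma shift_invariant_const (G : groupType) (A : finType) (e : config G A) :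
  (forall g, gshift g e = e) -> forall g, e g = e 1%g.
Proof. by move=> eG g; rewrite -[in LHS](eG g) /gshift mulVg. Qed.

(** A fixed point [e] is constant, so inserting its value [e 1] into the local rule of the bracket
    leaves one self-map [u] of [B], the same in every cell. *)
Lemma cellwise_ad_collision (K : finFieldType) (G : groupType) (B : finType)
    (Y : lie_subshift K G B) (e : config G B) :
  cellwise Y -> lie_carrier Y e -> (forall g, gshift g e = e) ->
  exists m n : nat, m <> n /\ forall y, lie_carrier Y y ->
    iter m (lie_bracket Y e) y = iter n (lie_bracket Y e) y.
Proof.
move=> [_ _ _ [F FE]] Ye eG.
pose u b := F [ffun=> (e 1%g, b)].
have adE y g : lie_carrier Y y -> lie_bracket Y e y g = u (y g).
  move=> Yy.
  have -> : lie_bracket Y e y g = _ := FE (fun h => (e h, y h)) (conj Ye Yy) g.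
  congr (F _); apply/ffunP => -[n /= nN]; rewrite !ffunE /gshift /=.
  by move: nN; rewrite inE => /eqP->; rewrite invgK mulg1 shift_invariant_const.
have adY y : lie_carrier Y y -> lie_carrier Y (lie_bracket Y e y).
  by move=> Yy; have [adY _ _] := lie_bracket_code Y;
    exact: (adY (fun h => (e h, y h))).
have iterE n y : lie_carrier Y y -> lie_carrier Y (iter n (lie_bracket Y e) y)
    /\ forall g, iter n (lie_bracket Y e) y g = iter n u (y g).
  move=> Yy; elim: n => [|n [IHY IHn]] //=; split; first exact: adY.
  by move=> g; rewrite adE // IHn.
have [m [n [mn uE]]] := fin_iter_collision u.
exists m, n; split=> // y Yy; apply/funext => g.
by rewrite (iterE m y Yy).2 (iterE n y Yy).2 uE.
Qed.

(** A conjugacy of Lie algebras sends [e] to a fixed point and intertwines the two adjoint maps; by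
    injectivity, a collision of powers in [Y] pulls back to [X]. *)
Lemma not_cellwiseable (K : finFieldType) (G : groupType) (A : finType)
    (X : lie_subshift K G A) (e : config G A) :
  lie_carrier X e -> (forall g, gshift g e = e) ->
  (forall m n : nat, (forall x, lie_carrier X x ->
    iter m (lie_bracket X e) x = iter n (lie_bracket X e) x) -> m = n) ->
  ~ cellwiseable X.
Proof.
move=> Xe eG adinj [B [Y [f [Ycell [[fXY _ fG] [_ finj _]] [_ _ fbr]]]]].
have feG g : gshift g (f e) = f e by rewrite -fG ?eG.
have [m [n [mn adE]]] := cellwise_ad_collision Ycell (fXY _ Xe) feG.
have adX x : lie_carrier X x -> lie_carrier X (lie_bracket X e x).
  by move=> Xx; have [adX _ _] := lie_bracket_code X;
    exact: (adX (fun h => (e h, x h))).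
have iterX k x : lie_carrier X x -> lie_carrier X (iter k (lie_bracket X e) x).
  by move=> Xx; elim: k => //= k; exact: adX.
have fE k x : lie_carrier X x ->
    f (iter k (lie_bracket X e) x) = iter k (lie_bracket Y (f e)) (f x).
  move=> Xx; elim: k => //= k <-; rewrite fbr ?inE //; exact: iterX.
apply: mn; apply: adinj => x Xx; apply: finj; rewrite ?inE; [exact: iterX..|].
by rewrite !fE // adE //; exact: fXY.
Qed.

(** * Maps applied in each cell *)

Lemma continuous_cellwise (G : groupType) (A B : finType) (p : A -> B) :
  continuous ((fun x h => p (x h)) : config G A -> config G B).
Proof.
apply/continuous_configP => x g.
apply: (@filterS _ _ (nbhs_filter x)) (nbhs_config_coord x g).
by move=> y /= ->.
Qed.

Lemma cellwise_block_code (G : groupType) (A B : finType) (p : A -> B)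
    (X : set (config G A)) (Y : set (config G B)) :
  (forall x, X x -> Y (fun h => p (x h))) ->
  is_block_code X Y (fun x h => p (x h)).
Proof.
by move=> XY; split=> //; apply: continuous_subspaceT; exact: continuous_cellwise.
Qed.

(** * The semidirect product, its operations and the Lie axioms *)

Section Semidirect.
Variables (K : finFieldType) (d : nat) (G : groupType).
Variable f : config G 'rV[K]_d -> config G 'rV[K]_d.
Hypothesis f_lin : is_linear_ca f.

Let A : finType := (K * 'rV[K]_d)%type.

Lemma linear_ca_add (u v : config G 'rV[K]_d) (g : G) :
  f (fun h => (u h : 'rV[K]_d) + v h) g = (f u g : 'rV[K]_d) + f v g.
Proof.
have [_ fL] := f_lin; have := fL 1 u v.
by rewrite !scale1r => fuv; exact: (congr1 (@^~ g) fuv).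
Qed.

Lemma linear_ca_scale (a : K) (u : config G 'rV[K]_d) (g : G) :
  f (fun h => a *: (u h : 'rV[K]_d)) g = a *: (f u g : 'rV[K]_d).
Proof.
have [_ fL] := f_lin.
have f0 : f (fun=> 0) = (fun=> 0).
  (* Linearity with coefficient -1 at two zero vectors reads f(0) = -f(0) + f(0). *)
  have := fL (-1) 0 0; rewrite !scaleN1r oppr0 addr0 addNr; exact.
have := fL a u 0; rewrite addr0 => fau.
have := congr1 (@^~ g) fau.
rewrite /= => ->; rewrite [f 0]f0; exact: addr0.
Qed.

(** The layer at 0 is the ideal V, and the layers are its cosets. *)
Definition layer (s : K) : set (config G A) := [set x | forall g, (x g).1 = s].

(** The scalar from the factor [K] is repeated in every cell, so it can be read off anywhere. *)
Definition semidirect_carrier : set (config G A) :=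
  [set x | exists s, layer s x].

Definition semidirect_zero : config G A := fun=> (0, 0).

Definition semidirect_scale (a : K) (x : config G A) : config G A :=
  fun g => (a * (x g).1, a *: (x g).2).

Definition semidirect_add (x y : config G A) : config G A :=
  fun g => ((x g).1 + (y g).1, (x g).2 + (y g).2).

(** The derivation defining the product: V is abelian, so any linear self-map of it is a
    derivation. *)
Definition der (x : config G A) : config G 'rV[K]_d := f (fun h => (x h).2).

Definition semidirect_bracket (x y : config G A) : config G A :=
  fun g =>
    (0, (x g).1 *: (der y g : 'rV[K]_d) - (y g).1 *: (der x g : 'rV[K]_d)).

Lemma der_add x y g : der (semidirect_add x y) g = (der x g : 'rV[K]_d) + der y g.
Proof. exact: linear_ca_add. Qed.

Lemma der_scale a x g : der (semidirect_scale a x) g = a *: (der x g : 'rV[K]_d).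
Proof. exact: linear_ca_scale. Qed.

(** Serves the Jacobi identity. On layers the scalars are the same in all cells, so linearity takes
    them out of [f]. *)
Lemma der_bracket s t x y g : layer s x -> layer t y ->
  der (semidirect_bracket x y) g =
  s *: (f (der y) g : 'rV[K]_d) - t *: (f (der x) g : 'rV[K]_d).
Proof.
move=> xs yt; rewrite -!linear_ca_scale -scaleN1r -linear_ca_scale -linear_ca_add.
congr (f _ g); apply/funext => h.
by rewrite /semidirect_bracket /= xs yt scaleN1r.
Qed.

Lemma semidirect_subshift : is_subshift semidirect_carrier.
Proof.
split=> [p clp|g x [s xs]]; last by exists s => h; exact: xs.
(* A carrier point agreeing with [p] at both [g] and 1 forces the scalars of [p] in these two cells
   to be equal. *)
exists (p 1%g).1 => g.
have [x [[s xs] /= [<- <-]]] :=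
  clp _ (@filterI _ _ (nbhs_filter p) _ _
    (nbhs_config_coord p g) (nbhs_config_coord p 1%g)).
by rewrite !xs.
Qed.

Lemma semidirect_zero_code :
  is_block_code [set: config G unit] semidirect_carrier (nullary semidirect_zero).
Proof. by apply: (@cellwise_block_code _ unit A (fun=> (0, 0))) => x _; exists 0. Qed.

Lemma semidirect_scale_code a :
  is_block_code semidirect_carrier semidirect_carrier (semidirect_scale a).
Proof.
apply: (@cellwise_block_code _ A A (fun p => (a * p.1, a *: p.2))) => x [s xs].
by exists (a * s) => g /=; rewrite xs.
Qed.

Lemma semidirect_add_code :
  is_block_code (subshift_square semidirect_carrier) semidirect_carrier
    (binary semidirect_add).
Proof.
apply: (@cellwise_block_code _ (A * A)%type A
  (fun p => (p.1.1 + p.2.1, p.1.2 + p.2.2))) => x [[s xs] [t xt]].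
by exists (s + t) => g /=; rewrite xs xt.
Qed.

(** The bracket combines, in each cell, the scalars with the images under [f] of two cellwise
    projections, so continuity and equivariance come from those of [f]. *)
Lemma semidirect_bracket_code :
  is_block_code (subshift_square semidirect_carrier) semidirect_carrier
    (binary semidirect_bracket).
Proof.
have [[_ fW fG] _] := f_lin.
have [_ /(_ fW) fC] := continuous_subspace_setT f.
split=> [z _||g z _]; first by exists 0.
- have derC (p : A * A -> 'rV[K]_d) : continuous
      ((fun z => f (fun h => p (z h))) : config G (A * A)%type -> config G 'rV[K]_d).
    move=> z.
    exact: (continuous_comp (@continuous_cellwise _ (A * A)%type _ p z) (fC _)).
  apply: continuous_subspaceT; apply/continuous_configP => z g.
  have /continuous_configP/(_ z g) := derC (fun p => p.1.2).
  have /continuous_configP/(_ z g) := derC (fun p => p.2.2).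
  have := nbhs_config_coord z g.
  apply: (@filterS3 _ _ (nbhs_filter z)) => y /= yz der2 der1.
  by rewrite /binary /semidirect_bracket /der der1 der2 yz.
- have fGz (p : A * A -> 'rV[K]_d) :
      f (fun h => p (gshift g z h)) = gshift g (f (fun h => p (z h))).
    exact: (fG g (fun h => p (z h))).
  rewrite /binary /semidirect_bracket /der (fGz (fun p => p.1.2)).
  by rewrite (fGz (fun p => p.2.2)).
Qed.

Definition semidirect : lie_subshift K G A.
Proof.
refine (@LieSubshift K G A semidirect_carrier semidirect_zero semidirect_scale
  semidirect_add semidirect_bracket semidirect_subshift semidirect_zero_code
  semidirect_scale_code semidirect_add_code semidirect_bracket_code
  _ _ _ _ _ _ _ _ _ _ _ _ _ _).
- by move=> x y z _ _ _; apply/funext => g; congr pair; exact: addrA.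
- by move=> x y _ _; apply/funext => g; congr pair; exact: addrC.
- move=> x _; apply/funext => g.
  by rewrite /semidirect_add /= !add0r -surjective_pairing.
- move=> x /set_mem[s xs]; exists (semidirect_scale (-1) x).
    by exists (- 1 * s) => g /=; rewrite xs.
  by apply/funext => g; congr pair; rewrite /= ?mulN1r ?scaleN1r addNr.
- by move=> a b x _; apply/funext => g; congr pair; rewrite /= ?mulrA ?scalerA.
- move=> x _; apply/funext => g.
  by rewrite /semidirect_scale mul1r scale1r -surjective_pairing.
- by move=> a x y _ _; apply/funext => g; congr pair; rewrite /= ?mulrDr ?scalerDr.
- by move=> a b x _; apply/funext => g; congr pair; rewrite /= ?mulrDl ?scalerDl.
- move=> x y z _ _ _; apply/funext => g; congr pair; rewrite /= ?addr0 ?der_add //.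
  by apply/rowP => j; rewrite !mxE; ring.
- move=> x y z _ _ _; apply/funext => g; congr pair; rewrite /= ?addr0 ?der_add //.
  by apply/rowP => j; rewrite !mxE; ring.
- move=> a x y _ _; apply/funext => g; congr pair; rewrite /= ?mulr0 ?der_scale //.
  by apply/rowP => j; rewrite !mxE; ring.
- move=> a x y _ _; apply/funext => g; congr pair; rewrite /= ?mulr0 ?der_scale //.
  by apply/rowP => j; rewrite !mxE; ring.
- by move=> x _; apply/funext => g; congr pair; exact: subrr.
- move=> x y z /set_mem[s xs] /set_mem[t yt] /set_mem[r zr].
  apply/funext => g; congr pair; rewrite /= ?addr0 //.
  (* Inner brackets have scalar 0, so each double bracket contributes two terms, products of two
     scalars with a value of [f] applied twice; the six terms cancel in pairs. *)
  rewrite (der_bracket g yt zr) (der_bracket g zr xs) (der_bracket g xs yt).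
  by rewrite xs yt zr; apply/rowP => j; rewrite !mxE; ring.
Defined.

(** * Failure of cellwiseability *)

Lemma iter_bracket_one n (u : config G 'rV[K]_d) :
  iter n (semidirect_bracket (fun=> (1, 0))) (fun g => (0, u g)) =
  fun g => (0, iter n f u g).
Proof.
elim: n => //= n ->; apply/funext => g; congr pair.
by rewrite /= scale1r scale0r subr0.
Qed.

Lemma semidirect_not_cellwiseable : infinite_order f -> ~ cellwiseable semidirect.
Proof.
move=> finj; apply: (@not_cellwiseable _ _ _ semidirect (fun=> (1, 0))).
- by exists 1.
- by [].
move=> m n adE; apply: finj; apply/funext => u; apply/funext => g.
(* Testing the powers of the adjoint map on the points (0, u) recovers the powers of [f]. *)
have := congr1 (fun x : config G A => (x g).2) (adE (fun g => (0, u g)) _).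
by rewrite !iter_bracket_one; apply; exists 0.
Qed.

(** * Homoclinic points and the co-homoclinic factor *)

Lemma closure_homoclinic_semidirect : infinite_set [set: G] ->
  closure (homoclinic semidirect) = layer 0.
Proof.
move=> infG; apply/seteqP; split=> [p clp g|p p0 U /nbhs_configP[S SU]].
  have [y [/(homoclinicP _ _ infG)[[s ys] /(_ 1%g) fy] /= <-]] :=
    clp _ (nbhs_config_coord p g).
  (* If the scalar [s] of the homoclinic point [y] were nonzero, [y] would be nonzero in every cell,
     and the finite set [fy] would be all of [G]. *)
  rewrite ys; apply/eqP/negP => /negP/eqP s0.
  apply: infG; apply: sub_finite_set fy => h _ /= yh.
  by apply: s0; rewrite -(ys (h^-1 * 1)%g) yh.
(* The truncation of [p] to the finite set [S] is homoclinic and lies in the given neighborhood. *)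
exists (fun g => if g \in S then p g else (0, 0)); split; last first.
  by apply: SU => g gS; rewrite gS.
apply/(homoclinicP _ _ infG); split.
  by exists 0 => g; case: ifP => // _; rewrite p0.
(* The translate by [g] can be nonzero at [h] only if k = g^-1 h lies in [S], that is, g = h
   k^-1. *)
move=> h; apply: (@sub_finite_set _ _ ((fun k => h * k^-1)%g @` [set` S])).
  move=> g /=; case: ifP => // gS _; exists (g^-1 * h)%g => //.
  by rewrite invgM invgK mulVKg.
by apply: finite_image; exact: finite_seq.
Qed.

Lemma semidirect_coset s x : layer s x -> semidirect_add x @` layer 0 = layer s.
Proof.
move=> xs; apply/seteqP; split=> [_ [y y0 <-] g|z zs] /=.
  by rewrite xs y0 addr0.
(* This is z - x, whose scalar vanishes because [x] and [z] lie in the same layer. *)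
exists (fun g => (0, (z g).2 - (x g).2)) => //.
apply/funext => g; rewrite [RHS]surjective_pairing; congr pair => /=.
  by rewrite xs zs addr0.
by rewrite addrC subrK.
Qed.

Lemma cohomoclinic_semidirect : infinite_set [set: G] ->
  cohomoclinic_factor semidirect = range layer.
Proof.
move=> infG; rewrite /cohomoclinic_factor closure_homoclinic_semidirect //.
apply/seteqP; split=> [_ [x [s xs] <-]|_ [s _ <-]].
  by exists s => //; rewrite -(semidirect_coset xs).
have ls : layer s (fun=> (s, 0)) by [].
by exists (fun=> (s, 0)); [exists s|exact: semidirect_coset].
Qed.

Lemma coset_add_layer s t :
  coset_add semidirect (layer s) (layer t) = layer (s + t).
Proof.
apply/seteqP; split=> [_ [x xs [y yt <-]] g|z zst] /=.
  by rewrite xs yt.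
exists (fun=> (s, 0)) => //; exists (fun g => (t, (z g).2)) => //.
by apply/funext => g; rewrite [RHS]surjective_pairing zst; congr pair; exact: add0r.
Qed.

Lemma cohomoclinic_semidirect_isog : infinite_set [set: G] ->
  cohomoclinic_factor_isog semidirect K.
Proof.
move=> infG; rewrite /cohomoclinic_factor_isog cohomoclinic_semidirect //.
(* Picks a point of the coset and reads its scalar at the cell 1. Layers are nonempty, so the
   default [semidirect_zero] does not affect the value on them. *)
pose psi (C : set (config G A)) : K := (xget semidirect_zero C 1%g).1.
have psiE s : psi (layer s) = s.
  apply: (@xgetPex (config G A) semidirect_zero (layer s)).
  by exists (fun=> (s, 0)).
exists psi; last first.
  move=> C D /set_mem[s _ <-] /set_mem[t _ <-].
  by rewrite coset_add_layer !psiE.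
split=> [//|_ _ /set_mem[s _ <-] /set_mem[t _ <-]|s _].
  by rewrite !psiE => ->.
by exists (layer s) => //; exists s.
Qed.

End Semidirect.

Theorem theorem15 (K : finFieldType) (d : nat) (hd : (1 <= d)%N)
    (G : groupType)
    (hf : exists f : config G 'rV[K]_d -> config G 'rV[K]_d,
      is_linear_ca f /\ infinite_order f) :
  exists (A : finType) (X : lie_subshift K G A),
    ~ cellwiseable X /\ cohomoclinic_factor_isog X K.
Proof.
have [f [f_lin f_inf]] := hf.
exists (K * 'rV[K]_d)%type, (semidirect f_lin); split.
  exact: semidirect_not_cellwiseable.
by apply: cohomoclinic_semidirect_isog; exact: infinite_order_infinite f_inf.
Qed.
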